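(* Let $x,y>0$ and $r,s\in\mathbb{R}$. For $t\in\mathbb{R}$ let $H_{r,s;x,y}(t)=G(r+t,s+t;x,y)$, where $G$ denotes the Gini mean. Then the function $t\mapsto t\ln H_{r,s;x,y}(t)$ is convex (1) on $\left(-\frac{s+r}{2},0\right)$ if $s+r>0$; (2) on $\left(0,-\frac{s+r}{2}\right)$ if $s+r<0$.
   Context: For $x,y>0$ and $p,q\in\mathbb{R}$ the Gini mean is $G(p,q;x,y)=\left(\frac{x^q+y^q}{x^p+y^p}\right)^{1/(q-p)}$ if $p\neq q$, and $G(p,p;x,y)=\exp\left(\frac{x^p\ln x+y^p\ln y}{x^p+y^p}\right)$. Convexity is meant in the usual non-strict sense. *)

(* Defs.v *)
From HB Require Import structures.
From mathcomp Require Import all_boot all_order all_algebra.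
From mathcomp Require Import interval_inference.
From mathcomp Require Import all_classical all_reals all_analysis.

Set Implicit Arguments.
Unset Strict Implicit.
Unset Printing Implicit Defensive.

Import Order.TTheory GRing.Theory Num.Theory.
Import numFieldNormedType.Exports.

Local Open Scope classical_set_scope.
Local Open Scope ring_scope.

(* Intended for [0 < x] and [0 < y]; [powR] and [ln] take conventional values
   outside this range. *)
Definition gini_mean {R : realType} (p q x y : R) : R :=
  if p == q then
    expR ((x `^ p * ln x + y `^ p * ln y) / (x `^ p + y `^ p))
  else ((x `^ q + y `^ q) / (x `^ p + y `^ p)) `^ (q - p)^-1.

Definition gini_shift {R : realType} (r s x y t : R) : R :=
  gini_mean (r + t) (s + t) x y.

(* Main.v *)
Require Import Defs.
From HB Require Import structures.
From mathcomp Require Import all_boot all_order all_algebra.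
From mathcomp Require Import interval_inference.
From mathcomp Require Import all_classical all_reals all_analysis.
From mathcomp Require Import ring lra.

Set Implicit Arguments.
Unset Strict Implicit.
Unset Printing Implicit Defensive.

Import Order.TTheory GRing.Theory Num.Theory.
Import numFieldNormedType.Exports.

Local Open Scope classical_set_scope.
Local Open Scope ring_scope.

(** Put [a = ln x], [b = ln y], [S u = exp (u a) + exp (u b)] and
    [f t = ln (H t)].  Differentiating, [f' = K / D] with a constant [K >= 0] and
    [D t = exp (- (a + b) t) * S (s + t) * S (r + t)]; moreover
    [D v - D u] has the sign of [(v - u) (s + r + u + v)], so [D] decreases up
    to [- (s + r) / 2] and increases after it.  Hence on each of the two
    intervals [t f' t] is nondecreasing.  As [f' >= 0], [f] is nondecreasing
    too, and so is [(t f)' = t f' + f]. *)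

(** The point [c] is allowed to be an endpoint, so [u = v] is covered and users need no case
    split. *)
Lemma MVT_subitvoo (R : realType) (a b : R) (f df : R -> R) (u v : R) :
  (forall t, t \in `]a, b[ -> is_derive t 1 f (df t)) ->
  u \in `]a, b[ -> v \in `]a, b[ -> u <= v ->
  exists2 c, u <= c <= v & f v - f u = df c * (v - u).
Proof.
rewrite !in_itv/= => fdf /andP[au ub] /andP[av vb] uv.
have fdf' t : t \in `[u, v] -> is_derive t 1 f (df t).
  rewrite in_itv/= => /andP[ut tv].
  by apply: fdf; rewrite in_itv/= (lt_le_trans au ut) (le_lt_trans tv vb).
have fdfo t : t \in `]u, v[ -> is_derive t 1 f (df t).
  by move=> /subset_itv_oo_cc; exact: fdf'.
have fc : {within `[u, v], continuous f}.
  by apply: derivable_within_continuous => t /fdf' [].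
have [c cuv ->] := MVT_segment uv fdfo fc.
by exists c => //; move: cuv; rewrite in_itv.
Qed.

(** With [w] the convex combination of [u] and [v], the mean value theorem on [[u, w]] and [[w, v]]
    turns the convexity gap into [(1 - p) * p * (v - u) * (df d - df c)], where [c <= w <= d]. *)
Lemma convex_function_derive_ndecr (R : realType) (a b : R) (f df : R -> R) :
  (forall t, t \in `]a, b[ -> is_derive t 1 f (df t)) ->
  {in `]a, b[ &, {homo df : u v / u <= v}} ->
  convex_function (`]a, b[%classic : set R^o) f.
Proof.
move=> fdf dfle.
have main (p u v : R) : 0 <= p -> p <= 1 -> u \in `]a, b[ -> v \in `]a, b[ ->
    u <= v -> f (p * u + (1 - p) * v) <= p * f u + (1 - p) * f v.
  move=> p0 p1 uab vab uv; set w := p * u + _.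
  have q0 : 0 <= 1 - p by rewrite subr_ge0.
  have wu : w - u = (1 - p) * (v - u) by rewrite /w; ring.
  have vw : v - w = p * (v - u) by rewrite /w; ring.
  have vu0 : 0 <= v - u by rewrite subr_ge0.
  have uw : u <= w by rewrite -subr_ge0 wu mulr_ge0.
  have wv : w <= v by rewrite -subr_ge0 vw mulr_ge0.
  have inab t : u <= t -> t <= v -> t \in `]a, b[.
    move: uab vab; rewrite !in_itv/= => /andP[au _] /andP[_ vb] ut tv.
    by rewrite (lt_le_trans au ut) (le_lt_trans tv vb).
  have wab := inab _ uw wv.
  have [c /andP[uc cw] fwu] := MVT_subitvoo fdf uab wab uw.
  have [d /andP[wd dv] fvw] := MVT_subitvoo fdf wab vab wv.
  have cd : df c <= df d.
    apply: dfle; [exact: inab (le_trans cw wv)|exact: inab (le_trans uw wd) _|].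
    exact: le_trans cw wd.
  rewrite -subr_ge0 (_ : _ - _ = (1 - p) * (f v - f w) - p * (f w - f u)).
    rewrite fwu fvw wu vw.
    have -> : (1 - p) * (df d * (p * (v - u))) - p * (df c * ((1 - p) * (v - u)))
      = (1 - p) * p * (v - u) * (df d - df c) by ring.
    by rewrite !mulr_ge0 // subr_ge0.
  ring.
move=> p u v; rewrite !inE /= => uab vab; rewrite !convRE.
have p0 : 0 <= p%:num by [].
have p1 : p%:num <= 1 by [].
have [uv|vu] := leP u v; first exact: main.
(* If [v < u], the endpoints trade places and the weight [p] becomes [1 - p]. *)
suff : f ((1 - p%:num) * v + p%:num * u) <= (1 - p%:num) * f v + p%:num * f u.
  by rewrite [X in f X]addrC [X in _ <= X]addrC.
rewrite -{2 4}[p%:num](subKr 1); apply: main => //; exact: ltW.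
Qed.

Lemma convex_function_idM (R : realType) (a b : R) (f df : R -> R) :
  (forall t, t \in `]a, b[ -> is_derive t 1 f (df t)) ->
  (forall t, t \in `]a, b[ -> 0 <= df t) ->
  {in `]a, b[ &, {homo (fun t => t * df t) : u v / u <= v}} ->
  convex_function (`]a, b[%classic : set R^o) (fun t : R^o => t * f t).
Proof.
move=> fdf df0 tdf.
apply: (@convex_function_derive_ndecr _ _ _ _ (fun t => t * df t + f t)).
  move=> t /fdf ft; apply: is_derive_eq; rewrite /= /GRing.scale /=; ring.
move=> u v uab vab uv; apply: lerD; first exact: tdf.
have [c /andP[uc cv] fvu] := MVT_subitvoo fdf uab vab uv.
rewrite -subr_ge0 fvu mulr_ge0 ?subr_ge0 // df0 //.
move: uab vab; rewrite !in_itv/= => /andP[au _] /andP[_ vb].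
by rewrite (lt_le_trans au uc) (le_lt_trans cv vb).
Qed.

(** As [expR] is increasing, [expR u - expR v] has the sign of [u - v]; a sign question about
    exponentials thus becomes one about exponents. *)
Lemma mulr_expRB_ge0 (R : realType) (u v c : R) :
  0 <= (u - v) * c -> 0 <= (expR u - expR v) * c.
Proof.
have [uv|vu|->] := ltgtP u v; last by rewrite !subrr !mul0r.
- rewrite nmulr_rge0 ?subr_lt0 // => c0.
  by rewrite mulr_le0 // subr_le0 ler_expR // ltW.
- rewrite pmulr_rge0 ?subr_gt0 // => c0.
  by rewrite mulr_ge0 // subr_ge0 ler_expR // ltW.
Qed.

Definition exp_sum (R : realType) (a b u : R) : R :=
  expR (u * a) + expR (u * b).

Lemma exp_sum_gt0 (R : realType) (a b u : R) : 0 < exp_sum a b u.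
Proof. by rewrite addr_gt0 ?expR_gt0. Qed.

Lemma is_derive_expR_shiftM (R : realType) (k p t : R) :
  is_derive t 1 (fun t : R => expR ((p + t) * k)) (expR ((p + t) * k) * k).
Proof.
apply: is_derive1_comp; apply: is_derive_eq.
by rewrite /GRing.scale /=; ring.
Qed.

Lemma is_derive_exp_sum (R : realType) (a b p t : R) :
  is_derive t 1 (fun t : R => exp_sum a b (p + t))
    (expR ((p + t) * a) * a + expR ((p + t) * b) * b).
Proof. by apply: is_deriveD; exact: is_derive_expR_shiftM. Qed.

Lemma is_derive_ln_exp_sum (R : realType) (a b p t : R) :
  is_derive t 1 (fun t : R => ln (exp_sum a b (p + t)))
    ((expR ((p + t) * a) * a + expR ((p + t) * b) * b) / exp_sum a b (p + t)).
Proof.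
rewrite mulrC; apply: (@is_derive1_comp _ _ (fun t => exp_sum a b (p + t))).
- by apply: is_derive1_ln; exact: exp_sum_gt0.
- exact: is_derive_exp_sum.
Qed.

(** Logarithm of the Gini mean for [a = ln x], [b = ln y]: a difference quotient of
    [ln (exp_sum a b u)] in [u], or its derivative when [p = q]. *)
Definition ln_gini (R : realType) (a b p q : R) : R :=
  if p == q then (expR (p * a) * a + expR (p * b) * b) / exp_sum a b p
  else (ln (exp_sum a b q) - ln (exp_sum a b p)) / (q - p).

Lemma ln_gini_mean (R : realType) (x y p q : R) : 0 < x -> 0 < y ->
  ln (gini_mean p q x y) = ln_gini (ln x) (ln y) p q.
Proof.
move=> x0 y0; have powE u : x `^ u + y `^ u = exp_sum (ln x) (ln y) u.
  by rewrite /powR !gt_eqF.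
rewrite /gini_mean /ln_gini !powE; case: ifP => _.
  by rewrite expRK /powR !gt_eqF.
by rewrite ln_powR ln_div ?posrE ?exp_sum_gt0 // mulrC.
Qed.

(* The expanded product [exp_sum (s + t) * exp_sum (r + t)] divided by
   [expR ((a + b) * t)], see [gini_denE]. *)
Definition gini_den (R : realType) (a b r s t : R) : R :=
  expR ((s + r) * a + (a - b) * t) + expR ((s + r) * b - (a - b) * t) +
  (expR (s * a + r * b) + expR (r * a + s * b)).

Lemma gini_den_gt0 (R : realType) (a b r s t : R) : 0 < gini_den a b r s t.
Proof. by rewrite !addr_gt0 ?expR_gt0. Qed.

(** Each of the four products in the expansion contains [expR ((a + b) * t)]; what remains of the
    two mixed ones is free of [t]. *)
Lemma gini_denE (R : realType) (a b r s t : R) :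
  exp_sum a b (s + t) * exp_sum a b (r + t)
  = expR ((a + b) * t) * gini_den a b r s t.
Proof.
have e p q u : p + q = (a + b) * t + u -> expR p * expR q = expR ((a + b) * t) * expR u.
  by move=> pq; rewrite -!expRD pq.
rewrite /exp_sum /gini_den mulrDl 2!mulrDr.
rewrite (e ((s + t) * a) ((r + t) * a) ((s + r) * a + (a - b) * t)); last by ring.
rewrite (e ((s + t) * a) ((r + t) * b) (s * a + r * b)); last by ring.
rewrite (e ((s + t) * b) ((r + t) * a) (r * a + s * b)); last by ring.
rewrite (e ((s + t) * b) ((r + t) * b) ((s + r) * b - (a - b) * t)); last by ring.
ring.
Qed.

Lemma gini_den_diff_ge0 (R : realType) (a b r s u v : R) :
  0 <= (v - u) * (s + r + u + v) ->
  0 <= gini_den a b r s v - gini_den a b r s u.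
Proof.
move=> uv0.
(* The terms free of [t] cancel and the rest factors; the exponents differ by [(a - b) * (v - u)] in
   the first factor and by [(a - b) * (s + r + u + v)] in the second. *)
have -> : gini_den a b r s v - gini_den a b r s u =
    (expR ((a - b) * v) - expR ((a - b) * u)) *
    (expR ((s + r) * a) - expR ((s + r) * b - (a - b) * (u + v))).
  rewrite mulrBl 2!mulrBr -!expRD /gini_den.
  have -> : (a - b) * v + ((s + r) * b - (a - b) * (u + v)) =
    (s + r) * b - (a - b) * u by ring.
  have -> : (a - b) * u + ((s + r) * b - (a - b) * (u + v)) =
    (s + r) * b - (a - b) * v by ring.
  rewrite ![(a - b) * _ + _]addrC; ring.
apply: mulr_expRB_ge0; rewrite mulrC; apply: mulr_expRB_ge0; rewrite mulrC.
have -> : ((a - b) * v - (a - b) * u) *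
    ((s + r) * a - ((s + r) * b - (a - b) * (u + v))) =
  (a - b) ^+ 2 * ((v - u) * (s + r + u + v)) by ring.
by rewrite mulr_ge0 // sqr_ge0.
Qed.

Lemma is_derive_ln_gini (R : realType) (a b r s : R) : exists2 K : R, 0 <= K &
  forall t : R, is_derive t 1 (fun t : R => ln_gini a b (r + t) (s + t))
    (K / gini_den a b r s t).
Proof.
have denE t : gini_den a b r s t =
    exp_sum a b (s + t) * exp_sum a b (r + t) / expR ((a + b) * t).
  by rewrite gini_denE mulrAC divff ?mul1r // expR_eq0.
have prodE p q t : expR (p * a + q * b) =
    expR ((p + t) * a) * expR ((q + t) * b) / expR ((a + b) * t).
  by rewrite -expRD -expRB; congr expR; ring.
have E0 u : expR u != 0 :> R by rewrite expR_eq0.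
have S0 u : exp_sum a b u != 0 by rewrite gt_eqF // exp_sum_gt0.
have [rs|rs] := eqVneq r s.
  (* Here the function is [S' / S] at [r + t], and [S'' S - S' ^ 2 = (a - b) ^ 2 exp ((a + b) (r +
     t))]. *)
  exists ((a - b) ^+ 2 * expR (r * a + r * b)) => [|t].
    by rewrite mulr_ge0 ?sqr_ge0 ?expR_ge0.
  pose N : R -> R := (a \*: (fun u => expR ((r + u) * a))) +
    (b \*: (fun u => expR ((r + u) * b))).
  have dN : is_derive t 1 N (a * (expR ((r + t) * a) * a) +
                             b * (expR ((r + t) * b) * b)).
    by apply: is_deriveD; apply: is_deriveZ; exact: is_derive_expR_shiftM.
  rewrite (_ : (fun _ => _) = N * (fun t : R => (exp_sum a b (r + t))^-1));
    last first.
    apply/funext => u; rewrite /ln_gini -rs eqxx.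
    by rewrite [X in X + _]mulrC [X in _ + X]mulrC.
  have dS := is_derive_exp_sum a b r t.
  have dV := @is_deriveV _ (fun u : R => exp_sum a b (r + u)) _ _ _
    (S0 (r + t)) dS.
  apply: (is_derive_eq (is_deriveM dN dV)).
  rewrite denE (prodE r r t) -rs /GRing.scale /=.
  have -> : N t = a * expR ((r + t) * a) + b * expR ((r + t) * b) by [].
  have := S0 (r + t); rewrite /exp_sum => Srt0.
  by field; rewrite Srt0 E0.
have sr0 : s - r != 0 by rewrite subr_eq0 eq_sym.
(* In [S' (s + t) S (r + t) - S (s + t) S' (r + t)] the pure products cancel; the mixed ones leave
   this constant, up to [1 / (s - r)] and the factor [exp ((a + b) t)] shared with the
   denominator. *)
exists ((a - b) * (expR (s * a + r * b) - expR (r * a + s * b)) / (s - r)) => [|t].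
  set c := _ - expR _.
  (* Pulling out [(s - r) ^- 2] avoids a case split on the sign of [s - r]: the exponents in [c]
     differ by [(s - r) * (a - b)]. *)
  have -> : (a - b) * c / (s - r) = (s - r) ^- 2 * (c * ((s - r) * (a - b))).
    by field.
  rewrite mulr_ge0 ?invr_ge0 ?sqr_ge0 //; apply: mulr_expRB_ge0.
  have -> : (s * a + r * b - (r * a + s * b)) * ((s - r) * (a - b)) =
    ((s - r) * (a - b)) ^+ 2 by ring.
  exact: sqr_ge0.
pose L : R -> R := (s - r)^-1 \*: ((fun t => ln (exp_sum a b (s + t))) -
  (fun t => ln (exp_sum a b (r + t)))).
have dL := is_deriveZ (s - r)^-1
  (is_deriveB (is_derive_ln_exp_sum a b s t) (is_derive_ln_exp_sum a b r t)).
rewrite (_ : (fun _ => _) = L); last first.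
  apply/funext => u; rewrite /ln_gini (inj_eq (addIr u)) (negPf rs).
  by rewrite [LHS]mulrC opprD addrACA subrr addr0.
apply: (is_derive_eq dL).
rewrite denE mulrBr (prodE s r t) (prodE r s t) /GRing.scale /=.
have := S0 (r + t); have := S0 (s + t); rewrite /exp_sum => Sst0 Srt0.
by field; rewrite Sst0 Srt0 E0 sr0.
Qed.

Theorem theorem3 (R : realType) (x y r s : R) (hx : 0 < x) (hy : 0 < y) :
  (0 < s + r ->
     convex_function (`]- ((s + r) / 2), 0[%classic : set R^o)
       (fun t : R^o => t * ln (gini_shift r s x y t))) /\
  (s + r < 0 ->
     convex_function (`]0, - ((s + r) / 2)[%classic : set R^o)
       (fun t : R^o => t * ln (gini_shift r s x y t))).
Proof.
have [K K0 dH] := is_derive_ln_gini (ln x) (ln y) r s.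
set f := fun t : R => ln_gini _ _ (r + t) (s + t) in dH.
have -> : (fun t : R^o => t * ln (gini_shift r s x y t)) = (fun t => t * f t).
  by apply/funext => t; rewrite /gini_shift ln_gini_mean.
set D := gini_den _ _ r s in dH.
have D0 t : 0 < D t by exact: gini_den_gt0.
have dH0 t : 0 <= K / D t by rewrite divr_ge0 // ltW.
(* Monotonicity of [t / D t], with the positive denominators cleared. *)
have ler_dH u v : 0 <= v * D u - u * D v -> u * (K / D u) <= v * (K / D v).
  move=> uv; rewrite -subr_ge0.
  have -> : v * (K / D v) - u * (K / D u) =
      K / (D u * D v) * (v * D u - u * D v).
    by field; rewrite !gt_eqF.
  by rewrite mulr_ge0 // divr_ge0 // mulr_ge0 // ltW.
split=> sr0; apply: (convex_function_idM (df := fun t => K / D t)) => //.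
- move=> u v; rewrite !in_itv/= => /andP[lu u0] /andP[lv v0] uv.
  apply: ler_dH.
  (* Here [- u > 0], and [D u <= D v] because [s + r + u + v > 0]. *)
  have -> : v * D u - u * D v = (v - u) * D u + (- u) * (D v - D u) by ring.
  rewrite addr_ge0 // mulr_ge0 ?subr_ge0 ?oppr_ge0 //; try exact: ltW.
  rewrite -subr_ge0; apply: gini_den_diff_ge0; rewrite mulr_ge0 ?subr_ge0 //; lra.
- move=> u v; rewrite !in_itv/= => /andP[u0 lu] /andP[v0 lv] uv.
  apply: ler_dH.
  (* Here [v > 0], and [D v <= D u] because [s + r + u + v < 0]. *)
  have -> : v * D u - u * D v = (v - u) * D v + v * (D u - D v) by ring.
  rewrite addr_ge0 // mulr_ge0 ?subr_ge0 //; try exact: ltW.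
  rewrite -subr_ge0; apply: gini_den_diff_ge0; rewrite mulr_le0 ?subr_le0 //; lra.
Qed.
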